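(* Let $G$ be a finite directed graph with vertices $v_1,\dots,v_N$ in which every vertex has an incoming edge and an outgoing edge, and let $A_G(j,i)$ be the number of edges from $v_j$ to $v_i$. A family $f_i(x)$, $i=1,\dots,N$, of functions satisfying the relations $$f_i(x)=1+x f_i(x)\sum_{j=1}^N A_G(j,i)f_j(x),\qquad i=1,\dots,N,$$ uniquely exists in a neighborhood of the origin, and these functions are differentiable.
   Context: Directed graphs may have loops and multiple edges. The $f_i$ are functions of a variable $x$ near $0$.
   Formalization: Uniqueness is asserted among continuous families on a ball about the origin and on each smaller ball; among arbitrary functions it fails, since for one vertex with one loop f = 1 + x f² has two roots at each small x ≠ 0. *)

(* Defs.v *)
From HB Require Import structures.
From mathcomp Require Import all_boot all_order all_algebra.
From mathcomp Require Import complex.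
From mathcomp Require Import all_classical all_reals all_analysis.

Set Implicit Arguments.
Unset Strict Implicit.
Unset Printing Implicit Defensive.

Import Order.TTheory GRing.Theory Num.Theory.
Import numFieldNormedType.Exports.

Local Open Scope ring_scope.
Local Open Scope classical_set_scope.

(* Edges form an arbitrary finite type, so loops and multiple edges are
   allowed; the vertex v_(k+1) is the element k of 'I_N. *)
Record digraph (N : nat) := Digraph {
  edge : finType;
  source : edge -> 'I_N;
  target : edge -> 'I_N
}.

Definition has_incoming_edges (N : nat) (G : digraph N) : Prop :=
  forall i : 'I_N, exists e : edge G, target e = i.

Definition has_outgoing_edges (N : nat) (G : digraph N) : Prop :=
  forall i : 'I_N, exists e : edge G, source e = i.

Definition adj (N : nat) (G : digraph N) (j i : 'I_N) : nat :=
  #|[pred e : edge G | (source e == j) && (target e == i)]|.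

Definition solves_at (K : numFieldType) (N : nat) (G : digraph N)
    (f : 'I_N -> K -> K) (x : K) : Prop :=
  forall i : 'I_N,
    f i x = 1 + x * f i x * (\sum_(j < N) (adj G j i)%:R * f j x).

(* K is meant to be the reals or the complex numbers.  In a complex field
   0 < r forces r to be real, and [derivable (f i) x 1] is the existence of the
   limit of (f i (x + h) - f i x) / h as h in K tends to 0, that is, complex
   differentiability.
   Uniqueness is among continuous families, on the ball of radius r and on each
   smaller ball about 0.  Without continuity it fails: for one vertex with one
   loop the relation is f = 1 + x f^2, which has two roots at each small
   x <> 0, and one could choose between them pointwise. *)
Definition locally_uniquely_solvable (K : numFieldType) (N : nat)
    (G : digraph N) : Prop :=
  exists2 r : K, 0 < r & exists f : 'I_N -> K -> K,
    [/\ forall x : K, ball 0 r x -> solves_at G f x,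
        forall (i : 'I_N) (x : K), ball 0 r x -> derivable (f i) x 1 &
        forall (s : K) (g : 'I_N -> K -> K), 0 < s -> s <= r ->
          (forall (i : 'I_N) (x : K), ball 0 s x ->
             {for x, continuous (g i)}) ->
          (forall x : K, ball 0 s x -> solves_at G g x) ->
          forall (i : 'I_N) (x : K), ball 0 s x -> g i x = f i x].

(* Main.v *)
(** For x fixed, the relations say that the vector v = (f_i(x)) is a fixed point
    of the quadratic map v |-> 1 + x v.(A^T v).  For x small this map contracts
    the region |v_i| <= 3 in the l^1 norm, so it has exactly one fixed point
    there, and that fixed point satisfies |v_i| <= 2.  The gap between 2 and 3
    shows that for a continuous solution g the set where g agrees with the fixed
    point is open and closed; it contains 0, hence the whole ball.
    Differentiability: the difference quotients solve a linear equation with a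
    contracting operator, which tends to the linearization of the relations at
    the rate |h|, so they tend to the solution of the linearized equation. *)
Require Import Defs.
From mathcomp Require Import all_boot all_order all_algebra ring lra.
From mathcomp Require Import complex.
From mathcomp Require Import all_classical all_reals all_analysis.

Set Implicit Arguments.
Unset Strict Implicit.
Unset Printing Implicit Defensive.

Import Order.TTheory GRing.Theory Num.Theory.
Import numFieldNormedType.Exports.

Local Open Scope ring_scope.
Local Open Scope classical_set_scope.

(* The common ground of K = R and K = R[i]: the norm of K is read in R, where
   linear arithmetic is available. *)
Record real_norm (R : realType) (K : numFieldType) := RealNorm {
  emb : {rmorphism R -> K};
  rnorm : K -> R;
  rnormE : forall x, `|x| = emb (rnorm x);
  emb_le : {mono emb : a b / a <= b};
  geometric_limit : forall (u : nat -> K) (c : R),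
    (forall n, rnorm (u n.+1 - u n) <= c * 2^-1 ^+ n) ->
    exists l, forall e, 0 < e -> \forall n \near \oo, rnorm (l - u n) < e }.

(** * Real-valued norm and the topology of [K] expressed through it *)

Section RealNormTheory.
Context (R : realType) (K : numFieldType) (V : real_norm R K).
Local Notation nm := (rnorm V).

Lemma emb_inj : injective (emb V).
Proof. exact: inc_inj (emb_le V). Qed.

Lemma emb_lt : {mono emb V : a b / a < b}.
Proof. exact: leW_mono (emb_le V). Qed.

Lemma rnorm_ge0 x : 0 <= nm x.
Proof. by rewrite -(emb_le V) rmorph0 -rnormE. Qed.

Lemma rnorm0 : nm 0 = 0.
Proof. by apply: emb_inj; rewrite -rnormE normr0 rmorph0. Qed.

Lemma rnorm1 : nm 1 = 1.
Proof. by apply: emb_inj; rewrite -rnormE normr1 rmorph1. Qed.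

Lemma rnorm_eq0 x : nm x = 0 -> x = 0.
Proof. by move=> x0; apply/eqP; rewrite -normr_eq0 (rnormE V) x0 rmorph0. Qed.

Lemma rnormM x y : nm (x * y) = nm x * nm y.
Proof. by apply: emb_inj; rewrite rmorphM -!rnormE normrM. Qed.

Lemma rnormB x y : nm (x - y) = nm (y - x).
Proof. by apply: emb_inj; rewrite -!rnormE distrC. Qed.

Lemma rnormD x y : nm (x + y) <= nm x + nm y.
Proof. by rewrite -(emb_le V) rmorphD -!rnormE ler_normD. Qed.

Lemma rnorm_emb a : 0 <= a -> nm (emb V a) = a.
Proof.
move=> a0; apply: emb_inj; rewrite -rnormE ger0_norm //.
by rewrite -(rmorph0 (emb V)) emb_le.
Qed.

Lemma rnorm_nat n : nm n%:R = n%:R.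
Proof. by apply: emb_inj; rewrite -rnormE normr_nat rmorph_nat. Qed.

Lemma rnorm_sum (I : Type) (r : seq I) (F : I -> K) :
  nm (\sum_(i <- r) F i) <= \sum_(i <- r) nm (F i).
Proof.
elim/big_rec2: _ => [|i y x _ xy]; first by rewrite rnorm0.
by apply: le_trans (rnormD _ _) _; rewrite lerD2l.
Qed.

Lemma rnorm_archimedean (x : K) (c : R) :
  0 <= c -> (forall e, 0 < e -> nm x <= c * e) -> x = 0.
Proof.
move=> c0 H; apply: rnorm_eq0; apply: le_anti; rewrite rnorm_ge0 andbT.
apply/ler_addgt0Pr => e e0; rewrite add0r.
(* Division by [c + 1] because [c] may be 0. *)
have c1 : 0 < c + 1 by lra.
apply: le_trans (H _ (divr_gt0 e0 c1)) _.
by rewrite mulrA ler_pdivrMr // mulrC ler_pM2l //; lra.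
Qed.

Lemma ball_rnorm x a y : ball x (emb V a) y <-> nm (x - y) < a.
Proof. by rewrite -ball_normE /= (rnormE V) emb_lt. Qed.

(** A positive element is its own norm. Hence every radius in [K] is a real radius, and balls and
    limits can be treated with real numbers. *)
Lemma gt0_emb (e : K) : 0 < e -> 0 < nm e /\ e = emb V (nm e).
Proof.
move=> e0; have E : e = emb V (nm e) by rewrite -(rnormE V) gtr0_norm.
by split => //; rewrite -emb_lt -E rmorph0.
Qed.

Lemma near_rnorm x (P : set K) :
  (exists2 a, 0 < a & forall y, nm (x - y) < a -> P y) <-> (\near x, P x).
Proof.
split=> [[a a0 H]|/nbhs_ballP[e /= /gt0_emb [e0 E] H]].
  apply/nbhs_ballP; exists (emb V a) => /=.
    by rewrite -(rmorph0 (emb V)) emb_lt.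
  by move=> y /ball_rnorm /H.
by exists (nm e) => // y ye; apply: H; rewrite E; apply/ball_rnorm.
Qed.

(* A locally constant property spreads along the segment from 0 to y, since
   [0, 1] is connected. *)
Lemma ball_locally_constant (s : R) (P : K -> Prop) :
  (forall y, nm y < s -> \forall z \near y, P z <-> P y) -> P 0 ->
  forall y, nm y < s -> P y.
Proof.
move=> Ploc P0 y ys.
pose Q t := P (emb V t * y).
have Qloc (t : R) : 0 <= t <= 1 -> \forall z \near t, Q z <-> Q t.
  move=> /andP[t0 t1].
  have /Ploc/near_rnorm[a a0 H] : nm (emb V t * y) < s.
    rewrite rnormM rnorm_emb //; apply: le_lt_trans ys.
    by rewrite ler_piMl ?rnorm_ge0.
  (* The [+ 1] keeps the divisor positive when [y] is 0. *)
  have y1 : 0 < nm y + 1 by have := rnorm_ge0 y; lra.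
  apply/nbhs_ballP; exists (a / (nm y + 1)); first by rewrite /= divr_gt0.
  move=> z; rewrite -ball_normE /= ltr_pdivlMr // => tz; apply: H.
  rewrite -mulrBl -rmorphB rnormM.
  have -> : nm (emb V (t - z)) = `|t - z|.
    apply: emb_inj; rewrite -(rnormE V).
    have [tz0|tz0] := leP 0 (t - z).
      by rewrite !ger0_norm // -(rmorph0 (emb V)) emb_le.
    by rewrite !ltr0_norm ?rmorphN // -(rmorph0 (emb V)) emb_lt.
  by apply: le_lt_trans tz; rewrite ler_wpM2l // lerDl.
pose I01 : set R := `[0, 1].
(* Relative openness in the segment; applied to [Q] and to its complement, it makes [Q] relatively
   open and closed. *)
have near_set (Q' : R -> Prop) : (forall t, I01 t -> Q' t ->
    \forall z \near t, Q' z) -> I01 `&` Q' = I01 `&` (Q' : set R)°.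
  move=> H; rewrite eqEsubset; split=> t [tI Qt]; split=> //; first exact: H.
  exact: interior_subset Qt.
have I01E (t : R) : I01 t = (0 <= t <= 1) by rewrite /I01 /= in_itv.
have I0 : I01 0 by rewrite I01E lexx ler01.
have I1 : I01 1 by rewrite I01E lexx ler01.
have QB : I01 `&` Q = I01.
  apply: (segment_connected (a := 0) (b := 1)).
  - exists 0; split=> //.
    by rewrite /Q rmorph0 mul0r.
  - exists (Q : set R)°; first exact: open_interior.
    apply: near_set => t; rewrite I01E => /Qloc H Qt.
    by apply: filterS H => z [_]; apply.
  - exists (~` (~` (Q : set R))°); first exact/open_closedC/open_interior.
    have H : I01 `&` ~` Q = I01 `&` (~` (Q : set R))°.
      apply: near_set => t; rewrite I01E => /Qloc H nQt.
      by apply: filterS H => z [zt _] /zt.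
    rewrite eqEsubset; split=> t [tI Qt]; split=> //.
      by move=> /interior_subset; exact.
    apply: contrapT => nQt; apply: Qt.
    by have [] : (I01 `&` (~` (Q : set R))°) t by rewrite -H.
by move: I1; rewrite -QB => -[_]; rewrite /Q rmorph1 mul1r.
Qed.

End RealNormTheory.

(** * Contractions in the l^1 norm on balls of the sup norm *)

Section Contraction.
Context (R : realType) (K : numFieldType) (V : real_norm R K) (N : nat).
Local Notation nm := (rnorm V).
Implicit Types (u v w : 'I_N -> K).

Definition sumnorm v : R := \sum_(i < N) nm (v i).

Definition bounded_by (c : R) v := forall i, nm (v i) <= c.

Lemma sumnorm_ge0 v : 0 <= sumnorm v.
Proof. by apply: sumr_ge0 => i _; apply: rnorm_ge0. Qed.

Lemma le_sumnorm v i : nm (v i) <= sumnorm v.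
Proof.
rewrite /sumnorm (bigD1 i) //= lerDl; apply: sumr_ge0 => j _.
exact: rnorm_ge0.
Qed.

Lemma sumnorm_bound v c : bounded_by c v -> sumnorm v <= N%:R * c.
Proof.
move=> vc; apply: le_trans (ler_sum _ (fun i _ => vc i)) _.
by rewrite sumr_const card_ord mulr_natl.
Qed.

Lemma sumnormD u v w : (forall i, u i = v i + w i) ->
  sumnorm u <= sumnorm v + sumnorm w.
Proof.
by move=> E; rewrite -big_split /=; apply: ler_sum => i _; rewrite E rnormD.
Qed.

Lemma sumnormZ (x : K) v : sumnorm (fun i => x * v i) = nm x * sumnorm v.
Proof.
by rewrite /sumnorm mulr_sumr; apply: eq_bigr => i _; rewrite rnormM.
Qed.

Lemma sumnorm_dist_eq0 v w : sumnorm (fun i => v i - w i) <= 0 -> v = w.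
Proof.
move=> vw; apply: funext => i; apply/eqP; rewrite -subr_eq0; apply/eqP.
apply: (rnorm_eq0 (V := V)); apply: le_anti; rewrite rnorm_ge0 andbT.
exact: le_trans (le_sumnorm (fun i => v i - w i) i) vw.
Qed.

(** Invariance of the ball is kept separate: only existence of a fixed point uses it, not
    uniqueness. *)
Definition half_contracts (c : R) (T : ('I_N -> K) -> 'I_N -> K) :=
  forall v w, bounded_by c v -> bounded_by c w ->
    sumnorm (fun i => T v i - T w i) <= 2^-1 * sumnorm (fun i => v i - w i).

Lemma half_contracts_unique c T v w : half_contracts c T ->
  bounded_by c v -> bounded_by c w -> T v = v -> T w = w -> v = w.
Proof.
move=> Tc vc wc Tv Tw; apply: sumnorm_dist_eq0.
by have := Tc _ _ vc wc; rewrite Tv Tw; lra.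
Qed.

Lemma half_contracts_fixpoint c T : 0 <= c ->
  (forall v, bounded_by c v -> bounded_by c (T v)) -> half_contracts c T ->
  exists2 v, bounded_by c v & T v = v.
Proof.
move=> c0 Tc Th.
(* Picard iteration; the start 0 lies in the ball since [0 <= c]. *)
pose u n := iter n T (fun=> 0).
have uc n : bounded_by c (u n).
  by elim: n => [i|n IH]; [rewrite rnorm0 | exact: Tc].
have ustep n : sumnorm (fun i => u n.+1 i - u n i) <=
    sumnorm (fun i => u 1 i - u 0 i) * 2^-1 ^+ n.
  elim: n => [|n IH]; first by rewrite expr0 mulr1.
  apply: le_trans (Th _ _ (uc n.+1) (uc n)) _.
  by rewrite exprS mulrCA ler_pM2l // invr_gt0.
have /choice[l lP] i : exists l, forall e, 0 < e ->
    \forall n \near \oo, nm (l - u n i) < e.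
  apply: geometric_limit => n; apply: le_trans (ustep n).
  exact: (le_sumnorm (fun i => u n.+1 i - u n i)).
(* There are finitely many coordinates, so one [n] serves them all, together with its successor. *)
have lu e : 0 < e -> exists n, forall i,
    nm (l i - u n i) < e /\ nm (l i - u n.+1 i) < e.
  move=> e0.
  have : \forall n \near \oo, forall i, nm (l i - u n i) < e.
    by apply: filter_forall => i; apply: lP.
  by case=> m _ H; exists m => i; split; apply: H => /=.
have lc : bounded_by c l.
  move=> i; apply/ler_addgt0Pr => e /lu[n /(_ i)[ln _]].
  have := rnormD V (l i - u n i) (u n i); rewrite subrK.
  by have := uc n i; lra.
exists l => //; apply: funext => i; apply/eqP; rewrite -subr_eq0; apply/eqP.
(* [T l - l] splits into [T l - T (u n)], of size at most [N * e / 2], and [u n.+1 - l], of size at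
   most [e] in each coordinate. *)
apply: (rnorm_archimedean (V := V) (c := N%:R + 1)); first by rewrite addr_ge0.
move=> e /lu[n ln].
have d1 : sumnorm (fun j => l j - u n j) <= N%:R * e.
  by apply: sumnorm_bound => j; apply: ltW; have [] := ln j.
have := Th _ _ lc (uc n).
have := le_sumnorm (fun j => T l j - T (u n) j) i.
have := rnormD V (T l i - T (u n) i) (T (u n) i - l i).
rewrite addrA subrK (rnormB _ (T (u n) i)) /=.
have [_] := ln i; rewrite /=.
have := sumnorm_ge0 (fun j => l j - u n j).
by lra.
Qed.

End Contraction.

(** * The quadratic map: fixed points and their dependence on x *)

Section Quadratic.
Context (R : realType) (K : numFieldType) (V : real_norm R K) (N : nat).
Context (A : 'I_N -> 'I_N -> nat).
Local Notation nm := (rnorm V).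
Local Notation sn := (sumnorm V).
Implicit Types (u v w d : 'I_N -> K) (x : K) (c : R).

Definition adj_sum v i : K := \sum_(j < N) (A j i)%:R * v j.

(** A common bound for indegrees (sup norm estimates) and outdegrees (l^1 estimates). The summand 1
    makes it positive, so that one may divide by it. *)
Definition edge_bound : R := 1 + \sum_(j < N) \sum_(i < N) (A j i)%:R.
Local Notation b := edge_bound.

Lemma edge_bound_ge1 : 1 <= b.
Proof. by rewrite lerDl; apply: sumr_ge0 => j _; apply: sumr_ge0. Qed.

Lemma outdegree_le j : \sum_(i < N) (A j i)%:R <= b.
Proof.
rewrite /edge_bound [X in _ <= _ + X](bigD1 j) //= addrCA lerDl.
rewrite addr_ge0 //.
by apply: sumr_ge0 => k _; apply: sumr_ge0.
Qed.

Lemma indegree_le i : \sum_(j < N) (A j i)%:R <= b.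
Proof.
rewrite /edge_bound exchange_big [X in _ <= _ + X](bigD1 i) //= addrCA lerDl.
rewrite addr_ge0 //.
by apply: sumr_ge0 => k _; apply: sumr_ge0.
Qed.

Lemma adj_sumB v w i :
  adj_sum (fun j => v j - w j) i = adj_sum v i - adj_sum w i.
Proof. by rewrite -sumrB; apply: eq_bigr => j _; rewrite mulrBr. Qed.

Lemma rnorm_adj_sum v i : nm (adj_sum v i) <= \sum_(j < N) (A j i)%:R * nm (v j).
Proof.
apply: le_trans (rnorm_sum _ _ _) _; apply: ler_sum => j _.
by rewrite rnormM rnorm_nat.
Qed.

Lemma adj_sum_bound c v : 0 <= c -> bounded_by V c v ->
  bounded_by V (c * b) (adj_sum v).
Proof.
move=> c0 vc i; apply: le_trans (rnorm_adj_sum v i) _.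
apply: (@le_trans _ _ (\sum_(j < N) (A j i)%:R * c)).
  by apply: ler_sum => j _; apply: ler_wpM2l.
by rewrite -mulr_suml mulrC ler_wpM2l // indegree_le.
Qed.

Lemma sumnorm_adj_sum v : sn (adj_sum v) <= b * sn v.
Proof.
apply: le_trans (ler_sum _ (fun i _ => rnorm_adj_sum v i)) _.
rewrite exchange_big mulr_sumr; apply: ler_sum => j _ /=.
by rewrite -mulr_suml ler_wpM2r ?rnorm_ge0 // outdegree_le.
Qed.

Definition quad u v i : K := u i * adj_sum v i.

Lemma quad_bound (a c : R) u v : 0 <= a -> 0 <= c -> bounded_by V a u ->
  bounded_by V c v -> bounded_by V (a * c * b) (quad u v).
Proof.
move=> a0 c0 ua vc i; rewrite rnormM -mulrA.
by apply: ler_pM; rewrite ?rnorm_ge0 //; exact: adj_sum_bound.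
Qed.

Lemma sumnorm_quadl c u v : 0 <= c -> bounded_by V c u ->
  sn (quad u v) <= c * b * sn v.
Proof.
move=> c0 uc; rewrite -mulrA.
apply: (@le_trans _ _ (c * sn (adj_sum v))); last first.
  by rewrite ler_wpM2l // sumnorm_adj_sum.
rewrite mulr_sumr; apply: ler_sum => i _.
by rewrite rnormM ler_wpM2r ?rnorm_ge0.
Qed.

Lemma sumnorm_quadr c u v : 0 <= c -> bounded_by V c v ->
  sn (quad u v) <= c * b * sn u.
Proof.
move=> c0 vc; rewrite mulrC mulr_suml; apply: ler_sum => i _.
by rewrite rnormM ler_wpM2l ?rnorm_ge0 //; exact: adj_sum_bound.
Qed.

Definition quad_step x v i : K := 1 + x * quad v v i.

Lemma quad_step_bound c x v : 0 <= c -> nm x * b <= 12^-1 ->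
  bounded_by V c v -> bounded_by V (1 + c * c / 12) (quad_step x v).
Proof.
move=> c0 xb vc i; apply: le_trans (rnormD _ _ _) _.
rewrite rnorm1 lerD2l rnormM.
apply: le_trans (ler_wpM2l (rnorm_ge0 V x) (quad_bound c0 c0 vc vc i)) _.
rewrite mulrCA; apply: ler_wpM2l => //; exact: mulr_ge0.
Qed.

(* For e = v - v' the bracket is quad v v - quad v' v'; for v = v' it is the
   linearization of the quadratic map at v, applied to e. *)
Lemma quad_pair_contracts x v v' e : nm x * b <= 12^-1 ->
  bounded_by V 3 v -> bounded_by V 3 v' ->
  sn (fun i => x * (quad e v i + quad v' e i)) <= 2^-1 * sn e.
Proof.
move=> xb v3 v3'; rewrite sumnormZ.
have H : sn (fun i => quad e v i + quad v' e i) <= sn (quad e v) + sn (quad v' e).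
  exact: sumnormD.
have h1 := sumnorm_quadr e (ler0n R 3) v3.
have h2 := sumnorm_quadl e (ler0n R 3) v3'.
(* Each term contributes [3 * b]. The constant 12 is chosen so that [nm x * (6 * b)] is at most one
   half. *)
have h3 : sn (fun i => quad e v i + quad v' e i) <= 6 * b * sn e by lra.
apply: le_trans (ler_wpM2l (rnorm_ge0 V x) h3) _.
have := ler_wpM2r (sumnorm_ge0 V e) xb; lra.
Qed.

Lemma quad_step_contracts x : nm x * b <= 12^-1 ->
  half_contracts V 3 (quad_step x).
Proof.
move=> xb v w v3 w3.
apply: le_trans (quad_pair_contracts (fun i => v i - w i) xb v3 w3).
rewrite le_eqVlt; apply/orP; left; apply/eqP; apply: eq_bigr => i _; congr nm.
by rewrite /quad_step /quad adj_sumB; ring.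
Qed.

Lemma quad_step_fixpoint x : nm x * b <= 12^-1 ->
  exists2 v, bounded_by V 2 v & quad_step x v = v.
Proof.
move=> xb.
have [v v3 vE] : exists2 v, bounded_by V 3 v & quad_step x v = v.
  apply: half_contracts_fixpoint (quad_step_contracts xb) => // v v3 i.
  by have := quad_step_bound (ler0n R 3) xb v3 i; lra.
(* One application of the map improves the bound 3 to 1 + 9/12, which is below 2. *)
exists v => // i; rewrite -vE.
by have := quad_step_bound (ler0n R 3) xb v3 i; lra.
Qed.

(** Changing the parameter from [x] to [y] moves the map at [w] by at most [9 * N * b * nm (y - x)];
    the contraction at [x] costs a further factor 2. *)
Lemma quad_step_lipschitz x y v w :
  nm x * b <= 12^-1 -> bounded_by V 3 v -> bounded_by V 3 w ->
  quad_step x v = v -> quad_step y w = w ->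
  sn (fun i => w i - v i) <= 18 * N%:R * b * nm (y - x).
Proof.
move=> xb v3 w3 vE wE.
have H : sn (fun i => w i - v i) <= sn (fun i => (y - x) * quad w w i) +
    sn (fun i => quad_step x w i - quad_step x v i).
  apply: sumnormD => i.
  by rewrite -[in LHS]wE -[in LHS]vE /quad_step; ring.
have h1 := quad_step_contracts xb w3 v3.
rewrite sumnormZ in H.
have h2 := sumnorm_bound (quad_bound (ler0n R 3) (ler0n R 3) w3 w3).
have h3 := ler_wpM2l (rnorm_ge0 V (y - x)) h2.
lra.
Qed.

(* Implicit differentiation at x gives d = quad v v + x (quad d v + quad v d);
   the difference quotient q of v and w solves the perturbed equation
   q = quad w w + x (quad q w + quad v q). *)
Lemma quad_step_derivative x v : nm x * b <= 12^-1 -> bounded_by V 3 v ->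
  quad_step x v = v ->
  exists d, exists2 C, 0 <= C & forall h w, h != 0 -> bounded_by V 3 w ->
    quad_step (x + h) w = w ->
    forall i, nm (d i - h^-1 * (w i - v i)) <= C * nm h.
Proof.
move=> xb v3 vE.
have b1 := edge_bound_ge1.
pose L d i : K := quad v v i + x * (quad d v i + quad v d i).
have Lsub d d' : (fun i => L d i - L d' i) =
    (fun i => x * (quad (fun j => d j - d' j) v i +
                   quad v (fun j => d j - d' j) i)).
  by apply: funext => i; rewrite /L /quad adj_sumB; ring.
have LC c : half_contracts V c L.
  by move=> d d' _ _; rewrite Lsub; exact: quad_pair_contracts.
have c0 : 0 <= 18 * b by lra.
(* [L] preserves this ball: [quad v v] gives at most [9 * b], and the linear part at most
   [12^-1 * 6 * (18 * b)], again [9 * b]. *)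
have [d d18 dE] : exists2 d, bounded_by V (18 * b) d & L d = d.
  apply: half_contracts_fixpoint (LC _) => // d dc i.
  apply: le_trans (rnormD _ _ _) _.
  have h1 := quad_bound (ler0n R 3) (ler0n R 3) v3 v3 i.
  have h2 := quad_bound (ler0n R 3) c0 v3 dc i.
  have h3 := quad_bound c0 (ler0n R 3) dc v3 i.
  have h4 := rnormD V (quad d v i) (quad v d i).
  have h5 : nm (quad d v i + quad v d i) <= 18 * b * (6 * b) by lra.
  rewrite rnormM.
  have h6 := ler_wpM2l (rnorm_ge0 V x) h5.
  have h7 := ler_wpM2l c0 xb.
  lra.
exists d.
pose D := 18 * N%:R * b.
have D0 : 0 <= D by rewrite /D !mulr_ge0 //; lra.
(* The l^1 norm of [L q - q] is at most [(6 * b + D / 12) * sn e], and [sn e <= D * nm h]; the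
   factor 2 comes from the contraction. *)
exists (2 * ((6 * b + D / 12) * D)).
  by rewrite !mulr_ge0 //; lra.
move=> h w h0 w3 wE i.
pose q j := h^-1 * (w j - v j).
pose e j := w j - v j.
have eD : sn e <= D * nm h.
  have := quad_step_lipschitz xb v3 w3 vE wE.
  by rewrite addrC addKr.
have hq : sn q = nm h^-1 * sn e by rewrite sumnormZ.
have hh : nm h^-1 * nm h = 1 by rewrite -rnormM mulVf // rnorm1.
have qD : sn q <= D.
  rewrite hq; apply: le_trans (ler_wpM2l (rnorm_ge0 _ _) eD) _.
  by rewrite mulrCA hh mulr1.
have qE j : q j = quad w w j + x * (quad q w j + quad v q j).
  rewrite /q -[in LHS]wE -[in LHS]vE /quad_step /quad.
  have -> : adj_sum (fun j => h^-1 * (w j - v j)) j =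
      h^-1 * (adj_sum w j - adj_sum v j).
    rewrite -adj_sumB /adj_sum mulr_sumr; apply: eq_bigr => k _.
    by rewrite mulrCA.
  by field.
(* The quotient [q] is an almost fixed point of [L]: its distance to the fixed point [d] is at most
   twice the distance by which [L] moves it. *)
have H1 : sn (fun j => d j - q j) <= 2^-1 * sn (fun j => d j - q j) +
    sn (fun j => L q j - q j).
  apply: (@le_trans _ _ (sn (fun j => L d j - L q j) + sn (fun j => L q j - q j))).
    by apply: sumnormD => j; rewrite dE; ring.
  (* [L] contracts on every ball; this radius is merely large enough to contain both [d] and [q]. *)
  rewrite lerD2r; apply: (LC (sn d + sn q)) => j.
    by apply: le_trans (le_sumnorm V d j) _; rewrite lerDl sumnorm_ge0.
  by apply: le_trans (le_sumnorm V q j) _; rewrite lerDr sumnorm_ge0.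
have H2 : sn (fun j => L q j - q j) <=
    sn (fun j => -1 * (quad e w j + quad v e j)) + sn (fun j => - x * quad q e j).
  apply: sumnormD => j; rewrite qE /L /quad !adj_sumB /e; ring.
have H3 : sn (fun j => quad e w j + quad v e j) <= sn (quad e w) + sn (quad v e).
  exact: sumnormD.
have h1 := sumnorm_quadr e (ler0n R 3) w3.
have h2 := sumnorm_quadl e (ler0n R 3) v3.
have qb : bounded_by V D q by move=> j; apply: le_trans (le_sumnorm V q j) qD.
have h3 := ler_wpM2l (rnorm_ge0 V x) (sumnorm_quadl e D0 qb).
have h4 := ler_wpM2r (mulr_ge0 D0 (sumnorm_ge0 V e)) xb.
have k0 : 0 <= 6 * b + D / 12 by lra.
have h5 := ler_wpM2l k0 eD.
rewrite !sumnormZ in H2.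
have N1 : nm (-1) = 1 by rewrite -sub0r rnormB subr0 rnorm1.
have Nx : nm (- x) = nm x by rewrite -sub0r rnormB subr0.
rewrite N1 Nx in H2.
apply: le_trans (le_sumnorm V (fun j => d j - q j) i) _.
lra.
Qed.
End Quadratic.

(** * Local existence, differentiability and uniqueness over [K] *)

Section LocalSolution.
Context (R : realType) (K : numFieldType) (V : real_norm R K) (N : nat).
Context (G : digraph N).
Local Notation nm := (rnorm V).
Local Notation A := (adj G).
Local Notation b := (edge_bound R A).

Lemma solves_atP (f : 'I_N -> K -> K) x :
  solves_at G f x <-> quad_step A x (f^~ x) = f^~ x.
Proof.
split=> [H|H i].
  by apply: funext => i; rewrite /quad_step /quad mulrA [RHS]H.
by rewrite -[LHS](congr1 (@^~ i) H) /quad_step /quad mulrA.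
Qed.

Lemma near_dist_lt (g : K -> K) (y : K) (e : R) : 0 < e ->
  {for y, continuous g} -> \forall z \near y, nm (g y - g z) < e.
Proof.
move=> e0 /cvgrPdist_lt gy.
have /gy : 0 < emb V e by rewrite -(rmorph0 (emb V)) emb_lt.
by apply: filterS => z; rewrite (rnormE V) emb_lt.
Qed.

(* Solutions bounded by 3 are the fixed points of the contraction.  As such
   they are bounded by 2, so a continuous solution can neither enter nor leave
   the region where the bound 3 holds. *)
Lemma continuous_solution_unique (f g : 'I_N -> K -> K) (s : R) :
  (forall x, nm x < s -> nm x * b <= 12^-1) ->
  (forall x, nm x < s -> solves_at G f x /\ bounded_by V 2 (f^~ x)) ->
  (forall i x, nm x < s -> {for x, continuous (g i)}) ->
  (forall x, nm x < s -> solves_at G g x) ->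
  forall i x, nm x < s -> g i x = f i x.
Proof.
move=> sb fP gc gP i x xs.
pose P y := g^~ y = f^~ y.
have bounded_eq y : nm y < s -> bounded_by V 3 (g^~ y) -> P y.
  move=> ys g3; have [/solves_atP fE f2] := fP y ys.
  apply: half_contracts_unique (quad_step_contracts (sb y ys)) g3 _ _ fE.
    by move=> j; apply: le_trans (f2 j) _; lra.
  exact/solves_atP/gP.
(* Where [g] agrees with [f] it is bounded by 2, so at a point where it differs by less than 1/2 it
   is still below 3. *)
have close_eq y z : nm y < s -> nm z < s ->
    (forall j, nm (g j y - g j z) < 2^-1) -> P z -> P y.
  move=> ys zs yz Pz; apply: bounded_eq => // j.
  have := rnormD V (g j y - g j z) (g j z); rewrite subrK.
  have [_ /(_ j)] := fP z zs.
  by have := yz j; rewrite /= -(congr1 (@^~ j) Pz) /=; lra.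
suff : P x by move/(congr1 (@^~ i)).
apply: (ball_locally_constant (V := V) (s := s)) => // [y ys|]; last first.
  have s0 : nm 0 < s by rewrite rnorm0; apply: le_lt_trans xs; apply: rnorm_ge0.
  (* At the origin the relations force every value to be 1. *)
  apply: bounded_eq => // j; rewrite (gP 0 s0 j) !mul0r addr0 rnorm1; lra.
have near_s : \forall z \near y, nm z < s.
  apply/(near_rnorm V); exists (s - nm y); first by rewrite subr_gt0.
  move=> z yz; have := rnormD V (z - y) y; rewrite subrK rnormB.
  by move: yz; lra.
have near_g : \forall z \near y, forall j, nm (g j y - g j z) < 2^-1.
  apply: (filter_forall (F := nbhs y)) => j.
  by apply: near_dist_lt; [lra | exact: gc].
(* Both directions come from [close_eq], with the roles of [y] and [z] exchanged. *)
apply: filterS2 near_s near_g => z zs yz; split.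
  exact: (close_eq y z).
by apply: (close_eq z y) => // j; rewrite rnormB.
Qed.

Lemma real_norm_locally_solvable : locally_uniquely_solvable K G.
Proof.
have b0 : 0 < b := lt_le_trans ltr01 (edge_bound_ge1 R A).
pose r := 12^-1 / b.
have r0 : 0 < r by rewrite divr_gt0 // invr_gt0.
have rb x : nm x < r -> nm x * b <= 12^-1 by rewrite ltr_pdivlMr //; exact: ltW.
have ballE (a : R) x : ball 0 (emb V a) x <-> nm x < a.
  by rewrite ball_rnorm rnormB subr0.
have /choice[F FP] x : exists v, nm x * b <= 12^-1 ->
    bounded_by V 2 v /\ quad_step A x v = v.
  have [/quad_step_fixpoint[v v2 vE]|nb] := boolP (nm x * b <= 12^-1).
    by exists v.
  (* A default value where [x] is too large for the contraction. *)
  by exists (fun=> 0).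
have F3 x : nm x * b <= 12^-1 -> bounded_by V 3 (F x).
  by case/FP => F2 _ i; apply: le_trans (F2 i) _; lra.
have fP x : nm x < r ->
    solves_at G (fun i x => F x i) x /\ bounded_by V 2 (F x).
  by case/rb/FP => F2 FE; split => //; apply/solves_atP.
exists (emb V r); first by rewrite -(rmorph0 (emb V)) emb_lt.
exists (fun i x => F x i); split.
- by move=> x /ballE /fP[].
- move=> i x /ballE xr.
  have [F2 FE] := FP x (rb x xr).
  have [d [C C0 dP]] := quad_step_derivative (rb x xr) (F3 x (rb x xr)) FE.
  apply: (cvgP (d i)); apply/cvgrPdist_lt => e' /(gt0_emb V)[].
  move: (nm e') => e e0 -> {e'}.
  rewrite near_withinE; apply/(near_rnorm V).
  have C1 : 0 < C + 1 by lra.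
  (* The first bound keeps [x + h] in the ball; the second makes [C * nm h] smaller than [e], also
     when [C] is 0. *)
  exists (Num.min (r - nm x) (e / (C + 1))).
    by rewrite lt_min subr_gt0 xr divr_gt0.
  move=> h; rewrite rnormB subr0 lt_min ltr_pdivlMr // => /andP[hr he] h0.
  rewrite (rnormE V) emb_lt /= -[_ *: 1]/(h * 1) mulr1 (addrC h).
  have xhr : nm (x + h) < r by apply: le_lt_trans (rnormD _ _ _) _; lra.
  have [_ FhE] := FP _ (rb _ xhr).
  have := dP h _ h0 (F3 _ (rb _ xhr)) FhE i.
  rewrite -[_ *: _]/(h^-1 * _) => H; apply: le_lt_trans H _.
  have := rnorm_ge0 V h; lra.
- move=> s' g /(gt0_emb V)[_]; move: (nm s') => s -> {s'}.
  rewrite emb_le => sr gc gP i x /ballE xs.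
  apply: (continuous_solution_unique (f := fun i x => F x i)) xs => y.
  + by move=> ys; apply/rb/(lt_le_trans ys).
  + by move=> ys; apply/fP/(lt_le_trans ys).
  + by move=> z /ballE; exact: gc.
  + by move=> /ballE; exact: gP.
Qed.

End LocalSolution.

(** * The real and the complex field as instances *)

Section Instances.
Context (R : realType).

(** The telescoping series of [u] is dominated by a geometric series, hence converges absolutely. *)
Lemma geometric_limit_real (u : nat -> R) (c : R) :
  (forall n, `|u n.+1 - u n| <= c * 2^-1 ^+ n) ->
  exists l, forall e, 0 < e -> \forall n \near \oo, `|l - u n| < e.
Proof.
move=> uc.
have su : cvgn (series (telescope u)).
  apply: normed_cvg; apply: (series_le_cvg (v_ := geometric c 2^-1)) => //.
  - by move=> n; apply: normr_ge0.
  - by move=> n; apply: le_trans (uc n).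
  - by apply: is_cvg_geometric_series; rewrite ger0_norm //; lra.
exists (limn u); apply/cvgrPdist_lt.
have -> : u = fun n => u 0 + series (telescope u) n.
  by apply: funext => n; rewrite -eq_sum_telescope.
by apply: is_cvgD => //; exact: is_cvg_cst.
Qed.

(** Real and imaginary parts inherit the hypothesis, so the real case gives the two coordinates of
    the limit. *)
Lemma geometric_limit_complex (u : nat -> complex R) (c : R) :
  (forall n, ComplexField.Normc.normc (u n.+1 - u n) <= c * 2^-1 ^+ n) ->
  exists l, forall e, 0 < e ->
    \forall n \near \oo, ComplexField.Normc.normc (l - u n) < e.
Proof.
move=> uc.
have ReB (z w : complex R) : complex.Re (z - w) = complex.Re z - complex.Re w.
  by case: z; case: w.
have ImB (z w : complex R) : complex.Im (z - w) = complex.Im z - complex.Im w.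
  by case: z; case: w.
have Re_le (z : complex R) : `|complex.Re z| <= ComplexField.Normc.normc z.
  by rewrite -lecR; exact: normc_ge_Re.
have Im_le (z : complex R) : `|complex.Im z| <= ComplexField.Normc.normc z.
  case: z => x y /=; rewrite -sqrtr_sqr ler_sqrt ?addr_ge0 ?sqr_ge0 //.
  by rewrite lerDr sqr_ge0.
have normc_le (z : complex R) :
    ComplexField.Normc.normc z <= `|complex.Re z| + `|complex.Im z|.
  case: z => x y /=.
  rewrite -[leRHS]ger0_norm ?addr_ge0 // -sqrtr_sqr ler_sqrt ?sqr_ge0 //.
  rewrite -(real_normK (num_real x)) -(real_normK (num_real y)).
  have := mulr_ge0 (normr_ge0 x) (normr_ge0 y).
  by rewrite sqrrD; lra.
have [a aP] : exists l, forall e, 0 < e ->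
    \forall n \near \oo, `|l - complex.Re (u n)| < e.
  apply: (geometric_limit_real (c := c)) => n; apply: le_trans (uc n).
  by rewrite -ReB.
have [b bP] : exists l, forall e, 0 < e ->
    \forall n \near \oo, `|l - complex.Im (u n)| < e.
  apply: (geometric_limit_real (c := c)) => n; apply: le_trans (uc n).
  by rewrite -ImB.
exists (Complex a b) => e e0.
have e2 : 0 < e / 2 by lra.
apply: filterS2 (aP _ e2) (bP _ e2) => n an bn.
apply: le_lt_trans (normc_le _) _.
rewrite ReB ImB /=; lra.
Qed.

Definition real_norm_real : real_norm R R.
Proof.
refine (@RealNorm R R idfun (fun x => `|x|) _ _ geometric_limit_real) => //.
Defined.

Definition real_norm_complex : real_norm R (complex R).
Proof.
refine (@RealNorm R (complex R) (real_complex R)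
  (@ComplexField.Normc.normc R) _ _ geometric_limit_complex) => //.
exact: lecR.
Defined.
End Instances.

Theorem theorem6p5 (R : realType) (N : nat) (G : digraph N)
    (Gin : has_incoming_edges G) (Gout : has_outgoing_edges G) :
  locally_uniquely_solvable R G /\ locally_uniquely_solvable (complex R) G.
Proof.
split.
  exact: (real_norm_locally_solvable (real_norm_real R)).
exact: (real_norm_locally_solvable (real_norm_complex R)).
Qed.
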